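(* Let $e\geq 2$ be an integer, $q$ a prime power, and let $J_q(2e+1,e,e+1)$ be the doubled Grassmann graph over $\mathbb{F}_q$. Then $\mu(J_q(2e+1,e,e+1))\leq (q^{2e+2}-1)/(q-1)$.
   Context: For a connected graph $\Gamma$ with distance function $d$, a resolving set is a set of vertices $S=\{v_1,\ldots,v_k\}$ such that for any two distinct vertices $u,v$ the vectors $(d(u,v_1),\ldots,d(u,v_k))$ and $(d(v,v_1),\ldots,d(v,v_k))$ differ. The metric dimension $\mu(\Gamma)$ is the smallest size of a resolving set of $\Gamma$. The doubled Grassmann graph $J_q(2e+1,e,e+1)$ is the bipartite graph whose vertex set is the union of the set of $e$-dimensional subspaces and the set of $(e+1)$-dimensional subspaces of $\mathbb{F}_q^{2e+1}$, where an $e$-dimensional subspace $P$ and an $(e+1)$-dimensional subspace $Q$ are adjacent iff $P\subseteq Q$ (and there are no other edges). *)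

(* Defs.v *)
From HB Require Import structures.
From mathcomp Require Import all_boot all_order all_algebra all_field.

Set Implicit Arguments.
Unset Strict Implicit.
Unset Printing Implicit Defensive.

(* A simple graph on a finite type T is given by a symmetric irreflexive
   adjacency relation adj : rel T. *)
Section MetricDimension.

Variables (T : finType) (adj : rel T).

Definition has_walk (n : nat) (u v : T) : bool :=
  [exists p : n.-tuple T, path adj u p && (last u p == v)].

(* Every distance within a connected component is < #|T|, so the bounded search
   loses nothing; vertices in different components get the value #|T|, which
   plays the role of infinity (irrelevant for connected graphs). *)
Definition gdist (u v : T) : nat :=
  find (fun n => has_walk n u v) (iota 0 #|T|).

Definition resolving (S : {set T}) : bool :=
  [forall u, forall v, (u != v) ==> [exists s in S, gdist u s != gdist v s]].

(* The full vertex set is always resolving (resolvingT below), so the arg min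
   does range over a nonempty family. *)
Definition metric_dim : nat := #|[arg min_(S < [set: T] | resolving S) #|S|]|.

Lemma has_walkP n u v :
  reflect (exists p, [/\ path adj u p, last u p = v & size p = n])
          (has_walk n u v).
Proof.
apply: (iffP existsP) => [[p /andP[up /eqP pv]]|[p [up pv sp]]].
  by exists p; rewrite size_tuple.
have sp' : size p == n by apply/eqP.
by exists (Tuple sp'); rewrite /= up pv eqxx.
Qed.

Lemma gdist_spec u v : connect adj u v ->
  has_walk (gdist u v) u v /\ (forall n, has_walk n u v -> gdist u v <= n).
Proof.
move=> /connectP[p0 up0 ->]; have [p up Up _] := shortenP up0.
set v' := last u p.
have lt_p : size p < #|T|.
  by rewrite -[(size p).+1]/(size (u :: p)) -(card_uniqP Up) max_card.
have wp : has_walk (size p) u v' by apply/has_walkP; exists p.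
have hs : has (fun n => has_walk n u v') (iota 0 #|T|).
  by apply/hasP; exists (size p); rewrite // mem_iota.
have lt_d : gdist u v' < #|T| by rewrite -[ltnRHS](size_iota 0) -has_find.
split; first by have := nth_find 0 hs; rewrite nth_iota // -/(gdist u v').
move=> n wn; rewrite leqNgt; apply/negP => ltnd.
by have := before_find 0 ltnd; rewrite nth_iota ?wn // (ltn_trans ltnd).
Qed.

Lemma gdist_eq0 u v : (gdist u v == 0) = (u == v).
Proof.
have T0 : 0 < #|T| by apply/card_gt0P; exists u.
rewrite /gdist; case: #|T| T0 => // n _ /=.
have -> : has_walk 0 u v = (u == v).
  apply/idP/eqP => [/has_walkP[p [_ <- /size0nil->]]|->] //.
  by apply/has_walkP; exists [::].
by case: (u == v).
Qed.

Lemma resolvingT : resolving [set: T].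
Proof.
apply/forallP=> u; apply/forallP=> v; apply/implyP=> uv.
apply/existsP; exists u; rewrite inE /=; apply/negP => /eqP duv.
have := gdist_eq0 v u; rewrite -duv gdist_eq0 eqxx => /esym/eqP vu.
by rewrite vu eqxx in uv.
Qed.

Lemma metric_dimP :
  (exists2 S, resolving S & #|S| = metric_dim) /\
  (forall S, resolving S -> metric_dim <= #|S|).
Proof.
rewrite /metric_dim; case: arg_minnP => [|S RS minS]; first exact: resolvingT.
by split=> //; exists S.
Qed.

End MetricDimension.

HB.instance Definition _ (F : finFieldType) (vT : vectType F) :=
  CanIsCountable (@VectorInternalTheory.vs2mxK F vT).
HB.instance Definition _ (F : finFieldType) (vT : vectType F) :=
  isFinite.Build {vspace vT}
    (pcan_enumP (can_pcan (@VectorInternalTheory.vs2mxK F vT))).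

Section DoubledGrassmann.

Variables (F : finFieldType) (e : nat).

Local Notation subspace := {vspace 'rV[F]_(2 * e + 1)}.

Definition dgrass_vertex : predArgType :=
  {U : subspace | (\dim U == e) || (\dim U == e.+1)}.

HB.instance Definition _ := SubFinite.on dgrass_vertex.

Definition dgrass_incident (P Q : dgrass_vertex) : bool :=
  [&& \dim (val P) == e, \dim (val Q) == e.+1 & (val P <= val Q)%VS].

Definition dgrass_adj : rel dgrass_vertex :=
  fun U V => dgrass_incident U V || dgrass_incident V U.

Lemma dgrass_adj_sym : symmetric dgrass_adj.
Proof. by move=> U V; rewrite /dgrass_adj orbC. Qed.

Lemma dgrass_adj_irr : irreflexive dgrass_adj.
Proof.
move=> U; rewrite /dgrass_adj orbb /dgrass_incident.
by case: eqP => // ->; rewrite ltn_eqF.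
Qed.

End DoubledGrassmann.

(* Main.v *)
Require Import Defs.
From mathcomp Require Import all_boot all_order all_algebra all_field zify.

(** In the doubled Grassmann graph the distance between [U] and [V] is
    [dim U + dim V - 2 dim (U :&: V)]; its parity against any fixed vertex
    separates the two halves, and within one half it determines the cardinality
    [#|U :&: V|], that is, the inner product of the characteristic vectors of
    [U] and [V] in the space of rational functions on the ambient vector space
    ([q ^ (2 e + 1)]-dimensional).  A set of vertices whose characteristic
    vectors form a basis of the span of all of them is therefore resolving: two
    vertices of one half with the same distances to it have the same inner
    product with every vertex, hence coincide.  Such a set has at most
    [q ^ (2 e + 1)] elements, which is already below the stated bound. *)

Set Implicit Arguments.
Unset Strict Implicit.
Unset Printing Implicit Defensive.

Import GRing.Theory Num.Theory.

(** Descending [f] gives a walk of length [f u], since the Lipschitz bound forces each drop to be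
    exactly one; the same bound makes every walk to [v] at least that long. *)
Lemma gdist_eq_potential (T : finType) (adj : rel T) (v : T) (f : T -> nat) :
    f v = 0 -> (forall u, f u = 0 -> u = v) ->
    (forall u w, adj u w -> f u <= (f w).+1) ->
    (forall u, 0 < f u -> exists2 w, adj u w & f w < f u) ->
  forall u, gdist adj u v = f u.
Proof.
move=> fv f0 lip desc u.
have walk n : forall u, f u = n -> has_walk adj n u v.
  elim: n => [|n IHn] {}u fu; first by apply/has_walkP; exists [::]; rewrite (f0 u).
  have [|w auw ltw] := desc u; first by rewrite fu.
  have fw : f w = n by have := lip _ _ auw; lia.
  have /has_walkP[p [wp pv sp]] := IHn w fw.
  by apply/has_walkP; exists (w :: p); rewrite /= auw wp sp.
have lower p : forall u, path adj u p -> last u p = v -> f u <= size p.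
  elim: p => [|w p IHp] {}u /= => [_ ->|/andP[auw wp] pv]; first by rewrite fv.
  by apply: leq_trans (lip _ _ auw) _; rewrite ltnS IHp.
have wu := walk _ u erefl.
have /gdist_spec[/has_walkP[p [up pv sp]] min_d] : connect adj u v.
  by have /has_walkP[p [up pv _]] := wu; apply/connectP; exists p.
by apply/eqP; rewrite eqn_leq min_d //= -sp lower.
Qed.

Section Subspaces.

Variables (K : fieldType) (vT : vectType K).
Implicit Types U V W : {vspace vT}.

Lemma dim_addv_line U v : v \notin U -> \dim (U + <[v]>) = (\dim U).+1.
Proof.
move=> nUv; have := dimv_sum_cap U <[v]>; rewrite dim_vline.
have -> : (v != 0)%R by apply: contraNneq nUv => ->; rewrite mem0v.
suff -> : (U :&: <[v]>)%VS = 0%VS by rewrite dimv0 addn0 addn1.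
apply/eqP; rewrite -subv0; apply/subvP => x /memv_capP[Ux /vlineP[k xE]].
rewrite memv0 xE; apply: contraNT nUv; rewrite scaler_eq0 negb_or => /andP[k0 _].
by rewrite -[v](scalerK k0) -xE memvZ.
Qed.

Lemma exists_intermediate_vspace W U k :
    (W <= U)%VS -> \dim W <= k <= \dim U ->
  exists V, [/\ (W <= V)%VS, (V <= U)%VS & \dim V = k].
Proof.
move=> sWU; elim: k => [|k IHk] /andP[Wk kU].
  by exists W; split=> //; apply/eqP; rewrite -leqn0.
move: Wk; rewrite leq_eqVlt => /predU1P[<-|Wk]; first by exists W.
have [|V [sWV sVU dV]] := IHk; first by rewrite -ltnS Wk ltnW.
have /subvPn[x Ux nVx] : ~~ (U <= V)%VS.
  by apply: contraL kU => /dimvS; rewrite dV -leqNgt.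
exists (V + <[x]>)%VS; rewrite dim_addv_line // dV; split=> //.
  exact: subv_trans sWV (addvSl _ _).
by rewrite subv_add sVU -memvE.
Qed.

Lemma dim_capv_le U V : \dim (U :&: V) <= \dim U /\ \dim (U :&: V) <= \dim V.
Proof. by rewrite !dimvS ?capvSl ?capvSr. Qed.

(** For the second bound, [U + (U' :&: V)] lies in [U'] and its two summands meet in [U :&: V]. *)
Lemma dim_capv_step U U' V : (U <= U')%VS ->
  \dim (U :&: V) <= \dim (U' :&: V) /\
  \dim (U' :&: V) + \dim U <= \dim (U :&: V) + \dim U'.
Proof.
move=> sU; split; first by rewrite dimvS // capvS.
have /dimvS : (U + (U' :&: V) <= U')%VS by rewrite subv_add sU capvSl.
have := dimv_sum_cap U (U' :&: V); rewrite capvA (capv_idPl sU); lia.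
Qed.

Lemma capv_dim_eq U V : \dim U <= \dim (U :&: V) -> (U <= V)%VS.
Proof.
by move=> le; apply/capv_idPl/eqP; rewrite eqEdim capvSl.
Qed.

(** This is [\dim (U + V) - \dim (U :&: V)], the distance in the Hasse diagram of the subspace
    lattice. The natural-number subtraction never truncates. *)
Definition subspace_dist U V : nat := \dim U + \dim V - 2 * \dim (U :&: V).

Lemma subspace_distvv V : subspace_dist V V = 0.
Proof. by rewrite /subspace_dist capvv; lia. Qed.

Lemma subspace_dist_eq0 U V : subspace_dist U V = 0 -> U = V.
Proof.
rewrite /subspace_dist; have [h1 h2] := dim_capv_le U V => d0.
by apply/eqP; rewrite eqEdim capv_dim_eq /=; lia.
Qed.

Lemma subspace_dist_step U U' V : (U <= U')%VS -> \dim U' = (\dim U).+1 ->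
  subspace_dist U V <= (subspace_dist U' V).+1 /\
  subspace_dist U' V <= (subspace_dist U V).+1.
Proof.
move=> /(dim_capv_step V) + dU'; rewrite /subspace_dist.
by have := dim_capv_le U V; have := dim_capv_le U' V; lia.
Qed.

(** A vector of [V] outside [U] enlarges both [U] and [U :&: V], and the intersection counts
    twice. *)
Lemma subspace_dist_ascent U V : ~~ (V <= U)%VS ->
  exists W, [/\ (U <= W)%VS, \dim W = (\dim U).+1
              & subspace_dist W V < subspace_dist U V].
Proof.
case/subvPn=> x Vx nUx; exists (U + <[x]>)%VS.
split; [exact: addvSl | exact: dim_addv_line |].
suff : \dim (U :&: V) < \dim ((U + <[x]>) :&: V).
  have := dim_capv_le U V; have := dim_capv_le (U + <[x]>)%VS V.
  by rewrite /subspace_dist dim_addv_line //; lia.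
have nx : x \notin (U :&: V)%VS by rewrite memv_cap (negPf nUx).
rewrite -(dim_addv_line nx) dimvS // subv_add capvS ?addvSl //=.
by rewrite -memvE memv_cap Vx andbT (subvP (addvSr U <[x]>)) // memv_line.
Qed.

Lemma subspace_dist_descent U V : ~~ (U <= V)%VS ->
  exists W, [/\ (W <= U)%VS, \dim U = (\dim W).+1
              & subspace_dist W V < subspace_dist U V].
Proof.
move=> nUV; have ltUV : \dim (U :&: V) < \dim U.
  by rewrite ltnNge; apply: contra nUV; apply: capv_dim_eq.
(* A hyperplane of [U] containing [U :&: V] loses a dimension without shrinking the intersection. *)
have [|W [sUVW sWU dW]] :=
  exists_intermediate_vspace (k := (\dim U).-1) (capvSl U V); first by lia.
have /dimvS : (U :&: V <= W :&: V)%VS by rewrite subv_cap sUVW capvSr.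
have := dim_capv_le W V; have := dim_capv_le U V.
by exists W; rewrite /subspace_dist; split=> //; lia.
Qed.

Lemma subspace_dist_odd U V W :
  subspace_dist U W = subspace_dist V W -> odd (\dim U) = odd (\dim V).
Proof.
rewrite /subspace_dist.
by have := dim_capv_le U W; have := dim_capv_le V W; lia.
Qed.

Lemma subspace_dist_cap U V W : \dim U = \dim V ->
  subspace_dist U W = subspace_dist V W -> \dim (U :&: W) = \dim (V :&: W).
Proof.
rewrite /subspace_dist.
by have := dim_capv_le U W; have := dim_capv_le V W; lia.
Qed.

End Subspaces.

Section Distance.

Variables (F : finFieldType) (e : nat).
Local Notation vertex := (dgrass_vertex F e).

Lemma dim_vertex (U : vertex) : \dim (val U) = e \/ \dim (val U) = e.+1.
Proof. by case/orP: (valP U) => /eqP; [left|right]. Qed.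

Lemma gdist_dgrass (U V : vertex) :
  gdist (@dgrass_adj F e) U V = subspace_dist (val U) (val V).
Proof.
apply: (gdist_eq_potential (f := fun W : vertex => subspace_dist (val W) (val V))).
- exact: subspace_distvv.
- by move=> {}U /subspace_dist_eq0/val_inj.
- move=> {}U W /orP[] /and3P[/eqP dU /eqP dW sUW].
    by case: (subspace_dist_step (val V) sUW) => //; rewrite dU.
  by case: (subspace_dist_step (val V) sUW) => //; rewrite dU.
move=> {}U dUV; have neqUV : val U != val V.
  by apply: contraTneq dUV => ->; rewrite subspace_distvv.
(* Going up from dimension [e] and down from [e.+1] keeps the walk inside the two levels of the
   graph. *)
case: (dim_vertex U) => dU.
  have [|W [sUW dW ltW]] := @subspace_dist_ascent _ _ (val U) (val V).
    apply: contra neqUV => sVU; rewrite eq_sym eqEdim sVU dU.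
    by case: (dim_vertex V) => -> /=; rewrite ?leqnn ?leqnSn.
  have Wvertex : (\dim W == e) || (\dim W == e.+1) by rewrite dW dU eqxx orbT.
  exists (Sub W Wvertex) => //.
  by apply/orP; left; apply/and3P; rewrite /= dW dU !eqxx.
have [|W [sWU dW ltW]] := @subspace_dist_descent _ _ (val U) (val V).
  apply: contra neqUV => sUV; rewrite eqEdim sUV dU.
  by case: (dim_vertex V) => -> /=; rewrite ?leqnn ?leqnSn.
have dWe : \dim W = e by apply: succn_inj; rewrite -dW dU.
have Wvertex : (\dim W == e) || (\dim W == e.+1) by rewrite dWe eqxx.
exists (Sub W Wvertex) => //.
by apply/orP; right; apply/and3P; rewrite /= dWe dU !eqxx.
Qed.

End Distance.

Local Open Scope ring_scope.

(** A maximal independent family of rows of the matrix of [f] spans the row space and has at most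
    [#|X|] members; a vector orthogonal to it is orthogonal to every row. *)
Lemma exists_small_spanning_set (K : fieldType) (I X : finType) (f : I -> X -> K) :
  exists2 A : {set I}, (#|A| <= #|X|)%N &
    forall g : X -> K, {in A, forall i, \sum_x f i x * g x = 0} ->
    forall i, \sum_x f i x * g x = 0.
Proof.
pose M := \matrix_(i < #|I|, j < #|X|) f (enum_val i) (enum_val j).
exists [set enum_val (maxrankfun M i) | i in [set: 'I_(\rank M)]].
  apply: leq_trans (leq_imset_card _ _) _.
  by rewrite cardsT card_ord rank_leq_col.
move=> g gA; pose c := \col_(j < #|X|) g (enum_val j).
have Mc m (h : 'I_m -> 'I_#|I|) i :
    (rowsub h M *m c) i 0 = \sum_x f (enum_val (h i)) x * g x.
  rewrite mxE (reindex (@enum_val X predT)) /=; last exact: onW_bij (enum_val_bij _).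
  by apply: eq_bigr => j _; rewrite !mxE.
have Ac0 : rowsub (maxrankfun M) M *m c = 0.
  apply/matrixP=> i j; rewrite ord1 Mc mxE gA //.
  by apply/imsetP; exists i; rewrite ?inE.
have /submxP[D MD] : (M <= rowsub (maxrankfun M) M)%MS by rewrite eq_maxrowsub.
move=> i; have := Mc _ id (enum_rank i).
rewrite enum_rankK => <-.
have -> : rowsub id M = M by apply/matrixP=> a b; rewrite mxE.
by rewrite MD -mulmxA Ac0 mulmx0 mxE.
Qed.

Local Open Scope nat_scope.

Section Resolving.

Variables (F : finFieldType) (e : nat).
Local Notation vertex := (dgrass_vertex F e).

(** Rational values make inner products count points faithfully; in the characteristic of [F] these
    powers of [#|F|] could vanish. *)
Definition char_fun (U : vertex) (x : 'rV[F]_(2 * e + 1)) : rat :=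
  ((x \in val U)%:R)%R.

Lemma char_fun_dot (U V : vertex) :
  (\sum_x char_fun U x * char_fun V x = (#|F| ^ \dim (val U :&: val V))%:R)%R.
Proof.
rewrite -card_vspace -sum1_card natr_sum [RHS]big_mkcond; apply: eq_bigr => x _.
by rewrite /char_fun -natrM mulnb memv_cap; case: (_ && _).
Qed.

(** Testing against [W = U] already gives [\dim U = \dim (U :&: V)], hence [U = V] by equality of
    dimensions. *)
Lemma eq_of_char_fun_dot (U V : vertex) : \dim (val U) = \dim (val V) ->
    (forall W, \sum_x char_fun W x * (char_fun U x - char_fun V x) = 0)%R ->
  U = V.
Proof.
move=> dUV /(_ U); under eq_bigr do rewrite mulrBr.
rewrite sumrB !char_fun_dot capvv => /eqP.
rewrite subr_eq0 eqr_nat eqn_exp2l ?finNzRing_gt1 // => /eqP dcap.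
by apply/val_inj/eqP; rewrite eqEdim dUV leqnn andbT capv_dim_eq -?dcap.
Qed.

Lemma exists_small_resolving : exists2 S : {set vertex},
  resolving (@dgrass_adj F e) S & #|S| <= #|F| ^ (2 * e + 1).
Proof.
have [S] := exists_small_spanning_set char_fun.
rewrite card_mx mul1n => Scard Sspan; exists S => //.
apply/forallP=> U; apply/forallP=> V; apply/implyP; apply: contraR.
rewrite negb_exists => /forallP sameD; apply/eqP.
have {}sameD W : W \in S ->
      subspace_dist (val U) (val W) = subspace_dist (val V) (val W).
  by move=> SW; have := sameD W; rewrite SW /= negbK !gdist_dgrass => /eqP.
(* The parity argument needs a member of [S]. An empty [S] would make [char_fun U] orthogonal to
   itself, although its square norm is a power of [#|F|]. *)
case: (set_0Vmem S) => [S0|[W0 SW0]].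
  have /(_ U)/eqP : forall i : vertex, (\sum_x char_fun i x * char_fun U x = 0)%R.
    by apply: Sspan => W; rewrite S0 inE.
  by rewrite char_fun_dot pnatr_eq0 expn_eq0 -leqn0 leqNgt ltnW ?finNzRing_gt1.
have dUV : \dim (val U) = \dim (val V).
  have := subspace_dist_odd (sameD _ SW0).
  by case: (dim_vertex U) (dim_vertex V) => -> [] -> //=; case: odd.
apply: eq_of_char_fun_dot => // W; move: W.
apply: Sspan => W SW; under eq_bigr do rewrite mulrBr.
rewrite sumrB !char_fun_dot; apply/eqP; rewrite subr_eq0 eqr_nat.
apply/eqP; congr (_ ^ _).
by rewrite ![(val W :&: _)%VS]capvC; apply: subspace_dist_cap (sameD _ SW).
Qed.

End Resolving.

Theorem theorem3p2 (e q : nat) (he : 2 <= e) (F : finFieldType)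
    (hF : #|F| = q) :
  metric_dim (@dgrass_adj F e) <= (q ^ (2 * e + 2) - 1) %/ (q - 1).
Proof.
have [S resS cardS] := exists_small_resolving F e.
have [_ /(_ S resS) leS] := metric_dimP (@dgrass_adj F e).
apply: leq_trans leS (leq_trans cardS _).
have q_gt1 : 1 < q by rewrite -hF finNzRing_gt1.
(* Clearing the denominator leaves [q ^ (2 * e + 2) - q ^ (2 * e + 1) <= q ^ (2 * e + 2) - 1]. *)
rewrite hF leq_divRL ?subn_gt0 // mulnBr muln1 -expnSr addn2 addn1.
by rewrite leq_sub2l // expn_gt0 ltnW.
Qed.
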